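(* Let $\lambda$ be a nonzero real number, $r\geq 0$ an integer and $z\in\mathbb{C}$. Then, as formal power series in $t$, $$\langle z|e_\lambda^{r+\hat{n}}(t)|z\rangle=\langle z|e_\lambda^{r+a^\dagger a}(t)|z\rangle=\sum_{n=0}^\infty \phi_{n,\lambda}^{(r)}(|z|^2)\frac{t^n}{n!}.$$
   Context: Number states $|m\rangle$, $m\ge0$, form an orthonormal basis; $a|m\rangle=\sqrt{m}\,|m-1\rangle$ ($a|0\rangle=0$), $a^\dagger|m\rangle=\sqrt{m+1}\,|m+1\rangle$, $\hat n=a^\dagger a$. The coherent state is $|z\rangle=e^{-|z|^2/2}\sum_{m\ge0}\frac{z^m}{\sqrt{m!}}|m\rangle$, and $\langle z|A|z\rangle$ is the inner product of $|z\rangle$ with $A|z\rangle$. Degenerate falling factorials: $(x)_{0,\lambda}=1$, $(x)_{k,\lambda}=x(x-\lambda)\cdots(x-(k-1)\lambda)$, and similarly for operators. The degenerate exponential is $e_\lambda^x(t)=(1+\lambda t)^{x/\lambda}=\sum_{k\ge0}(x)_{k,\lambda}\frac{t^k}{k!}$, $e_\lambda(t)=e_\lambda^1(t)$; for the operator, $e_\lambda^{r+\hat n}(t)=\sum_{k\ge0}(\hat n+r)_{k,\lambda}\frac{t^k}{k!}$, so $\langle z|e_\lambda^{r+\hat n}(t)|z\rangle=\sum_{k\ge0}\langle z|(\hat n+r)_{k,\lambda}|z\rangle\frac{t^k}{k!}$. Degenerate $r$-Stirling numbers of the second kind: $(x+r)_{n,\lambda}=\sum_{k=0}^n \begin{Bmatrix}n+r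 \\ k+r \end{Bmatrix}_{r,\lambda}(x)_k$ with $(x)_k=x(x-1)\cdots(x-k+1)$. Degenerate $r$-Bell polynomials: $\phi_{n,\lambda}^{(r)}(x)=\sum_{k=0}^n \begin{Bmatrix}n+r \\ k+r \end{Bmatrix}_{r,\lambda}x^k$. *)

(* Defs.v *)
(* Stdlib reals with Coquelicot; [sum_n u n] is u 0 + ... + u n, with n+1
   terms. *)
From Stdlib Require Import Reals Lra Lia Arith ClassicalEpsilon.
From Coquelicot Require Import Coquelicot.
Open Scope R_scope.

(* (x)_{k,lambda}; the ordinary falling factorial (x)_k is [dfall 1 x k]. *)
Fixpoint dfall (lambda x : R) (k : nat) : R :=
  match k with
  | O => 1
  | S j => dfall lambda x j * (x - INR j * lambda)
  end.

(* [T n k] stands for {n+r over k+r}_{r,lambda}; an identity of polynomials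
   in x is an identity for all real x. *)
Definition is_dstirling (lambda : R) (r : nat) (T : nat -> nat -> R) : Prop :=
  forall (n : nat) (x : R),
    dfall lambda (x + INR r) n = sum_n (fun k => T n k * dfall 1 x k) n.

Fixpoint dstirling_rec (lambda : R) (r n k : nat) : R :=
  match n with
  | O => match k with O => 1 | S _ => 0 end
  | S m =>
      match k with O => 0 | S j => dstirling_rec lambda r m j end
      + (INR k + INR r - INR m * lambda) * dstirling_rec lambda r m k
  end.

Lemma dstirling_rec_gt lambda r n :
  forall k, (n < k)%nat -> dstirling_rec lambda r n k = 0.
Proof.
  induction n as [|m IH]; intros [|j] H; simpl dstirling_rec; try lia; auto.
  rewrite !IH by lia. ring.
Qed.

Lemma dstirling_exists (lambda : R) (r : nat) :
  exists T, is_dstirling lambda r T.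
Proof.
  exists (dstirling_rec lambda r).
  intros n x. rewrite sum_n_Reals. induction n as [|m IH].
  - simpl. lra.
  - change (dfall lambda (x + INR r) m * (x + INR r - INR m * lambda) =
      sum_f_R0 (fun k => dstirling_rec lambda r (S m) k * dfall 1 x k) (S m)).
    rewrite IH. clear IH.
    set (T := dstirling_rec lambda r).
    assert (H : forall N,
      sum_f_R0 (fun k => T (S m) k * dfall 1 x k) (S N) =
      sum_f_R0 (fun k => T m k * dfall 1 x k) N * (x + INR r - INR m * lambda)
      + (INR (S N) + INR r - INR m * lambda) * T m (S N) * dfall 1 x (S N)).
    { induction N as [|N IHN].
      - unfold T. simpl. ring.
      - rewrite tech5, IHN, tech5.
        change (T (S m) (S (S N))) with (T m (S N)
          + (INR (S (S N)) + INR r - INR m * lambda) * T m (S (S N))).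
        change (dfall 1 x (S (S N))) with (dfall 1 x (S N) * (x - INR (S N) * 1)).
        rewrite (S_INR (S N)). ring. }
    rewrite H. replace (T m (S m)) with 0; [ring|].
    symmetry. apply dstirling_rec_gt. lia.
Qed.

Definition dstirling (lambda : R) (r : nat) : nat -> nat -> R :=
  proj1_sig (constructive_indefinite_description _ (dstirling_exists lambda r)).

Lemma dstirling_spec (lambda : R) (r : nat) :
  is_dstirling lambda r (dstirling lambda r).
Proof.
  exact (proj2_sig
    (constructive_indefinite_description _ (dstirling_exists lambda r))).
Qed.

Lemma dfall1_zero (n k : nat) : (n < k)%nat -> dfall 1 (INR n) k = 0.
Proof.
  induction 1 as [|k _ IH]; simpl; [ring | rewrite IH; ring].
Qed.

Lemma dfall1_nonzero (n k : nat) : (k <= n)%nat -> dfall 1 (INR n) k <> 0.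
Proof.
  induction k as [|k IH]; intros H; simpl; [lra|].
  apply Rmult_integral_contrapositive_currified; [apply IH; lia|].
  assert (INR k < INR n) by (apply lt_INR; lia). lra.
Qed.

(* The defining identity determines the numbers in the range k <= n, the only
   one used below. *)
Lemma dstirling_unique (lambda : R) (r : nat) (T U : nat -> nat -> R) :
  is_dstirling lambda r T -> is_dstirling lambda r U ->
  forall n k, (k <= n)%nat -> T n k = U n k.
Proof.
  intros HT HU n k. induction k as [k IH] using lt_wf_ind. intros Hk.
  pose proof (eq_trans (eq_sym (HT n (INR k))) (HU n (INR k))) as E.
  rewrite !sum_n_Reals in E.
  assert (trunc : forall V : nat -> nat -> R, forall N, (k <= N)%nat ->
    sum_f_R0 (fun i => V n i * dfall 1 (INR k) i) N =
    sum_f_R0 (fun i => V n i * dfall 1 (INR k) i) k).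
  { intros V N HN. induction HN as [|N HN IHN]; [reflexivity|].
    rewrite tech5, IHN, dfall1_zero by lia. ring. }
  rewrite (trunc T n Hk), (trunc U n Hk) in E.
  pose proof (dfall1_nonzero k k (le_n k)) as Hnz.
  destruct k as [|k].
  - simpl in E. lra.
  - rewrite !tech5 in E.
    rewrite (sum_eq _ (fun i => U n i * dfall 1 (INR (S k)) i) k) in E.
    + apply Rplus_eq_reg_l in E. now apply Rmult_eq_reg_r in E.
    + intros i Hi. rewrite IH by lia. reflexivity.
Qed.

Definition dbell (lambda : R) (r n : nat) (x : R) : R :=
  sum_n (fun k => dstirling lambda r n k * x ^ k) n.

(* Vectors are given by their coordinates in the number basis; the Hilbert
   space is the subset [l2]. *)
Definition vec := nat -> C.

Definition l2 (f : vec) : Prop := ex_series (fun m => Cmod (f m) ^ 2).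

(* Conjugate-linear in the first argument.  The complex series is summed
   componentwise; it converges on [l2], see [inner_correct]. *)
Definition inner (f g : vec) : C :=
  (Series (fun m => Re (Cconj (f m) * g m)%C),
   Series (fun m => Im (Cconj (f m) * g m)%C)).

Lemma inner_correct (f g : vec) : l2 f -> l2 g ->
  is_series (fun m => (Cconj (f m) * g m)%C : C_R_NormedModule) (inner f g).
Proof.
  intros Hf Hg.
  assert (B : ex_series (fun m => Cmod (f m) ^ 2 + Cmod (g m) ^ 2))
    by (apply (ex_series_plus _ _ Hf Hg)).
  assert (D : forall m,
    Cmod (Cconj (f m) * g m)%C <= Cmod (f m) ^ 2 + Cmod (g m) ^ 2).
  { intros m. rewrite Cmod_mult, Cmod_conj.
    pose proof (pow2_ge_0 (Cmod (f m) - Cmod (g m))).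
    pose proof (Cmod_ge_0 (f m)). pose proof (Cmod_ge_0 (g m)). nra. }
  assert (Dre : forall c : C, Rabs (Re c) <= Cmod c) by apply re_le_Cmod.
  assert (Dim : forall c : C, Rabs (Im c) <= Cmod c).
  { intros c. eapply Rle_trans; [apply Rmax_r | apply Rmax_Cmod]. }
  assert (Sre : is_series (fun m => Re (Cconj (f m) * g m)%C) (fst (inner f g))).
  { apply Series_correct, (@ex_series_le R_AbsRing R_CompleteNormedModule) with (2 := B).
    intros m. eapply Rle_trans; [apply Dre | apply D]. }
  assert (Sim : is_series (fun m => Im (Cconj (f m) * g m)%C) (snd (inner f g))).
  { apply Series_correct, (@ex_series_le R_AbsRing R_CompleteNormedModule) with (2 := B).
    intros m. eapply Rle_trans; [apply Dim | apply D]. }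
  set (u := fun m => (Cconj (f m) * g m)%C) in *.
  assert (P : forall n, @sum_n C_R_NormedModule u n =
    (sum_n (fun m => Re (u m)) n, sum_n (fun m => Im (u m)) n)).
  { induction n as [|n IH]; [rewrite !sum_O; now destruct (u 0%nat)|].
    rewrite !sum_Sn, IH. reflexivity. }
  unfold is_series.
  apply filterlim_ext with (1 := fun n => eq_sym (P n)).
  pose proof (filterlim_pair _ _ Sre Sim) as L.
  intros Q [eps HQ]. apply L.
  exists (ball (fst (inner f g)) eps) (ball (snd (inner f g)) eps);
    try (exists eps; tauto).
  intros x y Hx Hy. apply HQ. now split.
Qed.

(* The number state |m>. *)
Definition ket (m : nat) : vec := fun j => if Nat.eq_dec j m then 1%C else 0%C.

Lemma Series_single (u : nat -> R) (m : nat) :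
  (forall j, j <> m -> u j = 0) -> Series u = u m.
Proof.
  intros H. apply is_series_unique.
  assert (P : forall N, sum_f_R0 u N = if le_dec m N then u m else 0).
  { induction N as [|N IH].
    - simpl. destruct (le_dec m 0).
      + now replace m with 0%nat by lia.
      + apply H. lia.
    - rewrite tech5, IH. destruct (le_dec m N), (le_dec m (S N)); try lia.
      + rewrite (H (S N)) by lia. ring.
      + replace (S N) with m by lia. ring.
      + rewrite (H (S N)) by lia. ring. }
  apply (filterlim_ext_loc (fun _ => u m)).
  - exists m. intros N HN. rewrite sum_n_Reals, P.
    destruct (le_dec m N); [reflexivity | contradiction].
  - apply filterlim_const.
Qed.

(* Orthonormality and completeness of the number states. *)
Lemma inner_ket (m : nat) (f : vec) : inner (ket m) f = f m.
Proof.
  unfold inner.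
  rewrite (Series_single (fun j => Re _) m), (Series_single (fun j => Im _) m).
  - unfold ket. destruct (Nat.eq_dec m m) as [_|]; [|contradiction].
    destruct (f m) as [x y]. unfold Cconj, Cmult, Re, Im; simpl.
    f_equal; ring.
  - intros j Hj. unfold ket. destruct (Nat.eq_dec j m); [contradiction|].
    unfold Cconj, Cmult, Im; simpl. ring.
  - intros j Hj. unfold ket. destruct (Nat.eq_dec j m); [contradiction|].
    unfold Cconj, Cmult, Re; simpl. ring.
Qed.

(* [op_fun] is meaningful only on [op_dom], a subset of [l2] mapped into [l2];
   sums and compositions carry their natural (maximal) domains. *)
Record operator := Operator { op_dom : vec -> Prop; op_fun :> vec -> vec }.

Definition op_cst (c : C) : operator :=
  Operator l2 (fun f m => (c * f m)%C).

Definition op_scal (c : C) (A : operator) : operator :=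
  Operator (op_dom A) (fun f m => (c * A f m)%C).

Definition op_add (A B : operator) : operator :=
  Operator (fun f => op_dom A f /\ op_dom B f) (fun f m => (A f m + B f m)%C).

Definition op_comp (A B : operator) : operator :=
  Operator (fun f => op_dom B f /\ op_dom A (B f)) (fun f => A (B f)).

Definition annih_fun (f : vec) : vec :=
  fun m => (RtoC (sqrt (INR (S m))) * f (S m))%C.

Definition creat_fun (f : vec) : vec :=
  fun m => match m with
           | O => 0%C
           | S j => (RtoC (sqrt (INR (S j))) * f j)%C
           end.

Definition annih : operator := Operator (fun f => l2 f /\ l2 (annih_fun f)) annih_fun.
Definition creat : operator := Operator (fun f => l2 f /\ l2 (creat_fun f)) creat_fun.

Lemma annih_ket0 (j : nat) : annih (ket 0) j = 0%C.
Proof. simpl. unfold annih_fun, ket. simpl. ring. Qed.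

Lemma annih_ketS (m j : nat) :
  annih (ket (S m)) j = (RtoC (sqrt (INR (S m))) * ket m j)%C.
Proof.
  simpl op_fun. unfold annih_fun, ket.
  destruct (Nat.eq_dec (S j) (S m)), (Nat.eq_dec j m); try lia.
  - now subst.
  - ring.
Qed.

Lemma creat_ket (m j : nat) :
  creat (ket m) j = (RtoC (sqrt (INR (S m))) * ket (S m) j)%C.
Proof.
  simpl op_fun. unfold creat_fun, ket. destruct j as [|j].
  - destruct (Nat.eq_dec 0 (S m)); [lia | ring].
  - destruct (Nat.eq_dec (S j) (S m)), (Nat.eq_dec j m); try lia.
    + now subst.
    + ring.
Qed.

Definition number_op : operator := op_comp creat annih.

(* (A)_{k,lambda} = A (A - lambda) ... (A - (k-1) lambda). *)
Fixpoint op_dfall (lambda : R) (A : operator) (k : nat) : operator :=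
  match k with
  | O => op_cst 1
  | S j => op_comp (op_dfall lambda A j)
                   (op_add A (op_cst (RtoC (- (INR j * lambda)))))
  end.

Definition coherent (z : C) : vec :=
  fun m => (RtoC (exp (- (Cmod z ^ 2) / 2)) * (z ^ m / RtoC (sqrt (INR (fact m)))))%C.

(* A formal power series in t is its sequence of coefficients: [E k] is the
   coefficient of t^k. *)

Definition egf (c : nat -> C) : nat -> C := fun n => (c n / RtoC (INR (fact n)))%C.

(* e_lambda^A(t) = sum_k (A)_{k,lambda} t^k / k!. *)
Definition op_dexp (lambda : R) (A : operator) : nat -> operator :=
  fun k => op_scal (/ RtoC (INR (fact k))) (op_dfall lambda A k).

Definition braket (z : C) (A : operator) : C := inner (coherent z) (A (coherent z)).

Definition braket_fps (z : C) (E : nat -> operator) : nat -> C :=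
  fun k => braket z (E k).

(* Main.v *)
(* In the number basis every operator involved is diagonal: (n^ + r)_{k,lambda}
   multiplies the m-th coordinate by (m + r)_{k,lambda}, and the squared moduli of
   the coordinates of |z> are the Poisson weights e^{-x} x^m / m! with x = |z|^2.
   The k-th coefficient is therefore a Poisson expectation.  Expanding
   (m + r)_{k,lambda} in ordinary falling factorials (m)_j and using that the
   j-th factorial moment of the Poisson law is x^j gives the Bell polynomial. *)
Require Import Defs.
From Stdlib Require Import Reals Lra Lia Arith FunctionalExtensionality.
From Coquelicot Require Import Coquelicot.
Open Scope R_scope.

Lemma is_series_exp (x : R) :
  is_series (fun m => x ^ m / INR (fact m)) (exp x).
Proof.
  apply is_series_ext with (2 := is_exp_Reals x).
  intros m. rewrite pow_n_pow. reflexivity.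
Qed.

Lemma exp_INR_mult (n : nat) (x : R) : exp (INR n * x) = exp x ^ n.
Proof.
  induction n as [|n IH].
  - simpl. now rewrite Rmult_0_l, exp_0.
  - rewrite S_INR, Rmult_plus_distr_r, exp_plus, IH, Rmult_1_l. simpl. ring.
Qed.

Lemma ex_series_le_pos (u v : nat -> R) :
  (forall m, 0 <= u m <= v m) -> ex_series v -> ex_series u.
Proof.
  intros H. apply (@ex_series_le R_AbsRing R_CompleteNormedModule).
  intros m. destruct (H m) as [H0 H1].
  change (Rabs (u m) <= v m). now rewrite Rabs_pos_eq.
Qed.

Lemma is_series_sum_n (u : nat -> nat -> R) (l : nat -> R) (n : nat) :
  (forall k, is_series (u k) (l k)) ->
  is_series (fun m => sum_n (fun k => u k m) n) (sum_n l n).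
Proof.
  intros H. induction n as [|n IH].
  - rewrite sum_O. apply is_series_ext with (2 := H 0%nat).
    intros m. now rewrite sum_O.
  - rewrite sum_Sn. apply is_series_ext with (2 := is_series_plus _ _ _ _ IH (H (S n))).
    intros m. now rewrite sum_Sn.
Qed.

(** Splits off the leading factor of the falling factorial rather than the last one; at [x = INR m]
    it cancels the [m + 1] of [(m + 1)!]. *)
Lemma dfall1_S (x : R) (k : nat) : dfall 1 (x + 1) (S k) = (x + 1) * dfall 1 x k.
Proof.
  induction k as [|k IH]; [simpl; ring|].
  change (dfall 1 (x + 1) (S k) * (x + 1 - INR (S k) * 1)
    = (x + 1) * (dfall 1 x k * (x - INR k * 1))).
  rewrite IH, S_INR. ring.
Qed.

(** Since [(m+1)_{k+1} / (m+1)! = (m)_k / m!], shifting the index by one pulls out a factor [x] and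
    lowers [k] by one. The normalisation [exp (- x)] is left out. *)
Lemma is_series_factorial_moment (x : R) (k : nat) :
  is_series (fun m => dfall 1 (INR m) k * (x ^ m / INR (fact m))) (x ^ k * exp x).
Proof.
  induction k as [|k IH].
  - simpl pow. rewrite Rmult_1_l. apply is_series_ext with (2 := is_series_exp x).
    intros m. simpl. ring.
  - apply is_series_decr_1.
    rewrite (dfall1_zero 0 (S k)) by lia.
    match goal with |- is_series _ ?l => replace l with (x * (x ^ k * exp x)) end.
    2: { unfold plus, opp; simpl. ring. }
    apply is_series_ext with (2 := is_series_scal x _ _ IH).
    intros m. rewrite (S_INR m), dfall1_S, fact_simpl, mult_INR, S_INR.
    unfold scal; simpl; unfold mult; simpl.
    pose proof (pos_INR m). field. split; [apply INR_fact_neq_0 | lra].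
Qed.

(* The vectors in the domain of every power of the number operator. *)
Definition rapidly_decreasing (f : vec) : Prop :=
  forall p, ex_series (fun m => INR (S m) ^ p * Cmod (f m) ^ 2).

Lemma rapidly_decreasing_l2 (f g : vec) (K : R) (p : nat) :
  rapidly_decreasing f ->
  (forall m, Cmod (g m) ^ 2 <= K * (INR (S m) ^ p * Cmod (f m) ^ 2)) -> l2 g.
Proof.
  intros Hf H. eapply ex_series_le_pos; [|apply (ex_series_scal K _ (Hf p))].
  intros m. split; [apply pow2_ge_0 | apply H].
Qed.

(** A factor of linear growth costs two powers of the weight, which a condition on all [p] can
    afford. This stability allows the factors of [op_dfall] to be applied one after another. *)
Lemma rapidly_decreasing_le (f g : vec) (K : R) :
  rapidly_decreasing f ->
  (forall m, Cmod (g m) <= K * INR (S m) * Cmod (f m)) -> rapidly_decreasing g.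
Proof.
  intros Hf H p.
  eapply ex_series_le_pos; [|apply (ex_series_scal (K ^ 2) _ (Hf (p + 2)%nat))].
  intros m.
  assert (P : 0 <= INR (S m) ^ p) by apply pow_le, pos_INR.
  split; [apply Rmult_le_pos; [exact P | apply pow2_ge_0]|].
  change (INR (S m) ^ p * Cmod (g m) ^ 2
    <= K ^ 2 * (INR (S m) ^ (p + 2) * Cmod (f m) ^ 2)).
  replace (K ^ 2 * (INR (S m) ^ (p + 2) * Cmod (f m) ^ 2))
    with (INR (S m) ^ p * (K * INR (S m) * Cmod (f m)) ^ 2)
    by (rewrite pow_add; ring).
  apply Rmult_le_compat_l; [exact P|].
  apply pow_incr. split; [apply Cmod_ge_0 | apply H].
Qed.

Lemma number_op_diag (f : vec) (m : nat) : number_op f m = (RtoC (INR m) * f m)%C.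
Proof.
  simpl op_fun. unfold creat_fun, annih_fun. destruct m as [|m].
  - simpl. ring.
  - rewrite Cmult_assoc, <- RtoC_mult, sqrt_sqrt by apply pos_INR. reflexivity.
Qed.

Lemma number_op_dom (f : vec) : rapidly_decreasing f -> op_dom number_op f.
Proof.
  intros Hf.
  assert (H0 : l2 f).
  { apply (rapidly_decreasing_l2 f f 1 0 Hf). intros m. simpl. lra. }
  assert (H1 : l2 (annih_fun f)).
  (* The squared moduli of the coordinates of [a f] are the sequence [m |f_m|^2] shifted by one. *)
  { apply ex_series_ext with (fun m => INR (S m) * Cmod (f (S m)) ^ 2).
    - intros m. unfold annih_fun.
      rewrite Cmod_mult, Cmod_R, Rabs_pos_eq by apply sqrt_pos.
      rewrite Rpow_mult_distr, pow2_sqrt by apply pos_INR. reflexivity.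
    - apply (ex_series_incr_1 (fun m => INR m * Cmod (f m) ^ 2)).
      eapply ex_series_le_pos; [|apply (Hf 1%nat)].
      intros m. pose proof (pow2_ge_0 (Cmod (f m))). pose proof (pos_INR m).
      cbv beta. rewrite S_INR, pow_1. split; nra. }
  assert (H2 : l2 (number_op f)).
  { apply (rapidly_decreasing_l2 f _ 1 2 Hf). intros m.
    rewrite number_op_diag, Cmod_mult, Cmod_R, Rabs_pos_eq by apply pos_INR.
    rewrite Rmult_1_l, <- Rpow_mult_distr. apply pow_incr.
    pose proof (Cmod_ge_0 (f m)). pose proof (pos_INR m).
    rewrite S_INR. split; nra. }
  repeat split; assumption.
Qed.

(** The recursion of [op_dfall] applies its last factor to the vector first, so the induction
    hypothesis is needed at the image of [f] and [f] must stay general. *)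
Lemma op_dfall_diag (lambda : R) (r k : nat) (f : vec) (m : nat) :
  op_dfall lambda (op_add (op_cst (RtoC (INR r))) number_op) k f m
  = (RtoC (dfall lambda (INR m + INR r) k) * f m)%C.
Proof.
  revert f. induction k as [|k IH]; intros f; [reflexivity|].
  change (op_dfall lambda (op_add (op_cst (INR r)) number_op) k
    (fun m => (INR r * f m + number_op f m) + RtoC (- (INR k * lambda)) * f m)%C m
    = (RtoC (dfall lambda (INR m + INR r) k * (INR m + INR r - INR k * lambda)) * f m)%C).
  rewrite IH, number_op_diag.
  unfold Rminus. rewrite RtoC_mult, !RtoC_plus. ring.
Qed.

Lemma op_dfall_dom (lambda : R) (r k : nat) (f : vec) :
  rapidly_decreasing f ->
  op_dom (op_dfall lambda (op_add (op_cst (RtoC (INR r))) number_op) k) f.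
Proof.
  revert f. induction k as [|k IH]; intros f Hf.
  - apply (rapidly_decreasing_l2 f f 1 0 Hf). intros m. simpl. lra.
  - pose proof (number_op_dom f Hf) as HN.
    assert (H0 : l2 f) by apply HN.
    split; [exact (conj (conj H0 HN) H0)|].
    apply IH. set (c := INR r - INR k * lambda).
    (* The innermost factor multiplies coordinate [m] by [m + c], and
       [|m + c| <= (1 + |c|) (m + 1)]. *)
    apply (rapidly_decreasing_le f _ (1 + Rabs c) Hf). intros m.
    change (Cmod ((INR r * f m + number_op f m) + RtoC (- (INR k * lambda)) * f m)%C
      <= (1 + Rabs c) * INR (S m) * Cmod (f m)).
    replace ((INR r * f m + number_op f m) + RtoC (- (INR k * lambda)) * f m)%C
      with (RtoC (INR m + c) * f m)%C.
    2: { rewrite number_op_diag. unfold c, Rminus. rewrite !RtoC_plus. ring. }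
    rewrite Cmod_mult, Cmod_R.
    apply Rmult_le_compat_r; [apply Cmod_ge_0|].
    pose proof (Rabs_triang (INR m) c) as H. pose proof (pos_INR m).
    rewrite (Rabs_pos_eq (INR m)) in H by assumption.
    pose proof (Rabs_pos c). rewrite S_INR. nra.
Qed.

Lemma coherent_sqr_Cmod (z : C) (m : nat) :
  Cmod (coherent z m) ^ 2
  = exp (- Cmod z ^ 2) * ((Cmod z ^ 2) ^ m / INR (fact m)).
Proof.
  pose proof (INR_fact_lt_0 m) as F.
  pose proof (sqrt_lt_R0 _ F) as S.
  unfold coherent.
  rewrite Cmod_mult, Cmod_div, !Cmod_R, Cmod_pow.
  2: { intros E. apply RtoC_inj in E. lra. }
  rewrite (Rabs_pos_eq (exp _)) by apply Rlt_le, exp_pos.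
  rewrite (Rabs_pos_eq (sqrt _)) by lra.
  unfold Rdiv. rewrite !Rpow_mult_distr, pow_inv, pow2_sqrt by lra.
  rewrite <- !pow_mult, (Nat.mul_comm m 2).
  rewrite <- exp_INR_mult. do 2 f_equal. simpl. field.
Qed.

Lemma coherent_rapidly_decreasing (z : C) : rapidly_decreasing (coherent z).
Proof.
  intros p. set (x := Cmod z ^ 2).
  assert (Hx : 0 <= x) by apply pow2_ge_0.
  (* The dominating series is the exponential series at [e^p x], which converges whatever [p] is. *)
  eapply ex_series_le_pos;
    [|apply (ex_series_scal (exp (- x)));
      exists (exp (exp (INR p) * x)); apply is_series_exp].
  intros m. rewrite coherent_sqr_Cmod. fold x.
  change (0 <= INR (S m) ^ p * (exp (- x) * (x ^ m / INR (fact m)))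
    <= exp (- x) * ((exp (INR p) * x) ^ m / INR (fact m))).
  assert (Q : 0 <= exp (- x) * (x ^ m / INR (fact m))).
  { apply Rmult_le_pos; [apply Rlt_le, exp_pos|].
    apply Rdiv_le_0_compat; [now apply pow_le | apply INR_fact_lt_0]. }
  split; [apply Rmult_le_pos; [apply pow_le, pos_INR | exact Q]|].
  (* From 1 + m <= e^m, the weight (1 + m)^p is at most (e^p)^m. *)
  assert (B : INR (S m) ^ p <= exp (INR p) ^ m).
  { apply Rle_trans with (exp (INR m) ^ p).
    - apply pow_incr. split; [apply pos_INR|].
      rewrite S_INR, Rplus_comm. apply exp_ineq1_le.
    - rewrite <- !exp_INR_mult, Rmult_comm. lra. }
  replace (exp (- x) * ((exp (INR p) * x) ^ m / INR (fact m)))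
    with (exp (INR p) ^ m * (exp (- x) * (x ^ m / INR (fact m))))
    by (rewrite Rpow_mult_distr; unfold Rdiv; ring).
  now apply Rmult_le_compat_r.
Qed.

(** A Dobinski formula. The sum over [k] is finite, so it may be exchanged with the series over [m]
    for any real [x], whatever its sign. *)
Lemma is_series_dbell (lambda : R) (r n : nat) (x : R) :
  is_series (fun m => dfall lambda (INR m + INR r) n
      * (exp (- x) * (x ^ m / INR (fact m)))) (dbell lambda r n x).
Proof.
  apply is_series_ext with (fun m => sum_n (fun k =>
    (dstirling lambda r n k * exp (- x))
    * (dfall 1 (INR m) k * (x ^ m / INR (fact m)))) n).
  - intros m. rewrite (dstirling_spec lambda r n (INR m)).
    rewrite <- (sum_n_mult_r (K := R_Ring)). apply sum_n_ext. intros k.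
    unfold mult; simpl. ring.
  - replace (dbell lambda r n x) with (sum_n (fun k =>
      (dstirling lambda r n k * exp (- x)) * (x ^ k * exp x)) n).
    + apply is_series_sum_n. intros k.
      apply (is_series_scal (dstirling lambda r n k * exp (- x))
        _ _ (is_series_factorial_moment x k)).
    + apply sum_n_ext. intros k.
      transitivity (dstirling lambda r n k * x ^ k * (exp (- x) * exp x) : R).
      * simpl. ring.
      * rewrite <- exp_plus, Rplus_opp_l, exp_0. apply Rmult_1_r.
Qed.

Lemma inner_diag (f g : vec) (d : nat -> R) (l : R) :
  (forall m, g m = (RtoC (d m) * f m)%C) ->
  is_series (fun m => d m * Cmod (f m) ^ 2) l -> inner f g = RtoC l.
Proof.
  intros Hg Hl.
  assert (E : forall m, (Cconj (f m) * g m)%C = RtoC (d m * Cmod (f m) ^ 2)).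
  { intros m. rewrite Hg, RtoC_mult, Cmod2_conj. ring. }
  unfold inner, RtoC. f_equal.
  - apply is_series_unique. apply is_series_ext with (2 := Hl).
    intros m. now rewrite E.
  (* All imaginary parts vanish, so the choice of index 0 is arbitrary. *)
  - rewrite (Series_single _ 0%nat); intros; now rewrite E.
Qed.

Theorem theorem3 (lambda : R) (hlambda : lambda <> 0) (r : nat) (z : C) :
  (forall k : nat,
     op_dom (op_dexp lambda (op_add (op_cst (RtoC (INR r))) number_op) k) (coherent z))
  /\ braket_fps z (op_dexp lambda (op_add (op_cst (RtoC (INR r))) number_op))
     = braket_fps z (op_dexp lambda (op_add (op_cst (RtoC (INR r))) (op_comp creat annih)))
  /\ braket_fps z (op_dexp lambda (op_add (op_cst (RtoC (INR r))) (op_comp creat annih)))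
     = egf (fun n => RtoC (dbell lambda r n (Cmod z ^ 2))).
Proof.
  split; [|split; [reflexivity|]].
  - intros k. apply op_dfall_dom, coherent_rapidly_decreasing.
  - apply functional_extensionality. intros n.
    unfold egf. rewrite <- RtoC_div by apply INR_fact_neq_0.
    (* The eigenvalue on the [m]-th number state is [(m + r)_{n,lambda} / n!]. *)
    apply (inner_diag _ _ (fun m => / INR (fact n) * dfall lambda (INR m + INR r) n)).
    + intros m.
      change ((/ RtoC (INR (fact n))
        * op_dfall lambda (op_add (op_cst (INR r)) number_op) n (coherent z) m)%C
        = (RtoC (/ INR (fact n) * dfall lambda (INR m + INR r) n) * coherent z m)%C).
      rewrite op_dfall_diag, RtoC_mult, RtoC_inv by apply INR_fact_neq_0. ring.
    + unfold Rdiv. rewrite (Rmult_comm (dbell _ _ _ _)).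
      apply is_series_ext with (2 := is_series_scal (/ INR (fact n)) _ _
        (is_series_dbell lambda r n (Cmod z ^ 2))).
      intros m. rewrite coherent_sqr_Cmod. unfold scal; simpl; unfold mult; simpl. ring.
Qed.
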